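(* The ranks of the spherical $A_2$ buildings of order 2 with three chambers missing $G_1,\dots,G_6$ are \[ \mathrm{rk}(G_1)=\tfrac{18}{11},\quad \mathrm{rk}(G_2)=\tfrac{13}{8},\quad \mathrm{rk}(G_3)=\tfrac{105}{64},\quad \mathrm{rk}(G_4)=\tfrac{49}{31},\quad \mathrm{rk}(G_5)=\tfrac32,\quad \mathrm{rk}(G_6)=\tfrac32 . \]
   Context: Let $H$ be the incidence graph of the Fano plane, a 3-regular bipartite graph with 14 vertices and girth 6, regarded as a metric graph in which every edge has length $\pi/3$. The graphs $G_1,\dots,G_6$ are, up to isomorphism, the six graphs obtained from $H$ by deleting three pairwise disjoint open edges (keeping all vertices); each has 8 vertices of valency 3 and 6 of valency 2. Call maximal non-branching path a path joining two vertices of valency 3 all of whose interior vertices have valency 2. The list of lengths of maximal non-branching paths, with multiplicities, is: $G_1$: $\{(\pi/3,9),(\pi,3)\}$; $G_2$: $\{(\pi/3,8),(2\pi/3,2),(\pi,2)\}$; $G_3$: $\{(\pi/3,8),(2\pi/3,3),(4\pi/3,1)\}$; $G_4$: $\{(\pi/3,7),(2\pi/3,4),(\pi,1)\}$; $G_5$ and $G_6$: $\{(\pi/3,6),(2\pi/3,6)\}$. $G_5$ and $G_6$ are distinguished by the fact that $G_5$ contains a 6-cycle of edges all of whose vertices have valency 3, while $G_6$ does not. These data characterize each $G_i$ among the six graphs. CAT(0) rank of a metric graph: let $L$ be a finite metric graph of girth at least $2\pi$, and let $S$ be the set of its vertices of valency at least 3. Let $\Phi_L$ be the set of injective paths $\alpha:[0,\pi]\hookrightarrow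 L$ of length $\pi$ (parametrized by arc length) with $\alpha(0)\in S$; a path is determined by its starting point and its image (a path and its reverse, when both start at vertices of $S$, are counted as two elements). Assume $\Phi_L$ is nonempty and finite. For $\alpha\in\Phi_L$ let $q_\alpha=\mathrm{val}_L(\alpha(0))-1$, where $\mathrm{val}_L$ is the valency, and \[ N(\alpha)=|\{\beta\in\Phi_L\mid \beta\ne\alpha,\ \beta(0)=\alpha(0),\ \beta(\pi)=\alpha(\pi)\}|,\qquad \mathrm{rk}(\alpha)=1+\frac{N(\alpha)}{q_\alpha}. \] The rank of $L$ is $\mathrm{rk}(L)=\frac1{|\Phi_L|}\sum_{\alpha\in\Phi_L}\mathrm{rk}(\alpha)$. *)

(* Defs.v *)
From HB Require Import structures.
From mathcomp Require Import all_boot all_order all_algebra.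
From mathcomp Require Import finmap.
From mathcomp Require Import all_classical all_reals all_analysis.

Set Implicit Arguments.
Unset Strict Implicit.
Unset Printing Implicit Defensive.

Import Order.TTheory GRing.Theory Num.Theory.

Local Open Scope fset_scope.
Local Open Scope ring_scope.

(* Loops and multiple edges are allowed. The orientation of an edge from [src]
   to [tgt] only fixes the parametrization of that edge by [0, len e]. *)
Record mgraph (R : realType) := MGraph {
  vert : finType;
  edge : finType;
  src : edge -> vert;
  tgt : edge -> vert;
  len : edge -> R;
  len_gt0 : forall e, 0 < len e }.

Section MetricGraph.
Variables (R : realType) (L : mgraph R).

(* A loop counts twice. *)
Definition valency (v : vert L) : nat :=
  (#|[set e : edge L | src e == v]| + #|[set e : edge L | tgt e == v]|)%N.

(* Points of the geometric realization: a vertex, or [inr (e, t)] with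
   0 < t < len e, the interior point of e at distance t from [src e]. *)
Definition mpoint : Type := (vert L + edge L * R)%type.

(* Characteristic map [0, len e] -> L of the edge e. *)
Definition chart (e : edge L) (t : R) : mpoint :=
  if t == 0 then inl (src e)
  else if t == len e then inl (tgt e)
  else inr (e, t).

Definition time : Type := {t : R | 0 <= t <= pi}.

Lemma time0_subproof : 0 <= (0 : R) <= pi.
Proof. by rewrite lexx pi_ge0. Qed.

Lemma timepi_subproof : 0 <= (pi : R) <= pi.
Proof. by rewrite lexx pi_ge0. Qed.

Definition time0 : time := exist _ 0 time0_subproof.
Definition timepi : time := exist _ pi timepi_subproof.

(* Piecewise linear paths parametrized by arc length: [0, pi] is cut into
   finitely many intervals, on each of which the path runs along one edge at
   speed 1, forwards or backwards. *)
Definition unit_speed (alpha : time -> mpoint) : Prop :=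
  exists (n : nat) (cut : nat -> R),
    [/\ cut 0%N = 0, cut n = pi,
        forall i, (i < n)%N -> cut i <= cut i.+1
      & forall i, (i < n)%N ->
        exists (e : edge L) (c : R) (back : bool), forall x : time,
          cut i <= val x <= cut i.+1 ->
          let t := c + (-1) ^+ back * val x in
          0 <= t <= len e /\ alpha x = chart e t].

Definition Phi : set (time -> mpoint) :=
  [set alpha | [/\ unit_speed alpha, injective alpha
    & exists v : vert L, alpha time0 = inl v /\ (3 <= valency v)%N]]%classic.

Definition coterminal (alpha : time -> mpoint) : set (time -> mpoint) :=
  [set beta | [/\ Phi beta, beta <> alpha, beta time0 = alpha time0
    & beta timepi = alpha timepi]]%classic.

(* The value at non-vertices is irrelevant. *)
Definition point_valency (p : mpoint) : nat :=
  if p is inl v then valency v else 2%N.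

(* [fset_set] is the finite set underlying a finite set. *)
Definition path_rank (alpha : time -> mpoint) : R :=
  1 + #|` fset_set (coterminal alpha)|%:R
      / (point_valency (alpha time0)).-1%:R.

(* Meaningful when [Phi] is finite and nonempty; in all other cases the
   conventions for [fset_set] and division make it 0. *)
Definition cat0_rank : R :=
  (\sum_(alpha <- fset_set Phi) path_rank alpha) / #|` fset_set Phi|%:R.

(* Oriented edges; [true] reverses the orientation. *)
Definition dart : finType := (edge L * bool)%type.
Definition origin (d : dart) : vert L := if d.2 then tgt d.1 else src d.1.
Definition terminus (d : dart) : vert L := if d.2 then src d.1 else tgt d.1.

Definition walk (x : vert L) (p : seq dart) : bool :=
  map origin p == belast x (map terminus p).

Definition walk_length (p : seq dart) : R := \sum_(d <- p) len d.1.

Definition nonbranching (x : vert L) (p : seq dart) : bool :=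
  [&& p != [::], walk x p, uniq (x :: map terminus p),
      valency x == 3%N, valency (last x (map terminus p)) == 3%N
    & all (fun v => valency v == 2%N) (behead (belast x (map terminus p)))].

(* Number of maximal non-branching paths of length l. The sum counts each of
   them twice, once in each direction; having no repeated vertex, it uses
   fewer than #|vert L| edges. *)
Definition nonbranching_mult (l : R) : nat :=
  (\sum_(k < #|vert L|)
     #|[set xp : vert L * k.-tuple dart |
         nonbranching xp.1 xp.2 && (walk_length xp.2 == l)]|)./2.

(* The list s, up to order, is the list with multiplicities of the lengths of
   the maximal non-branching paths. *)
Definition nonbranching_lengths (s : seq R) : Prop :=
  forall l : R, nonbranching_mult l = count_mem l s.

Definition has_branching_6cycle : Prop :=
  exists (x : vert L) (p : 6.-tuple dart),
    [/\ walk x p, last x (map terminus p) = x, uniq (map terminus p)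
      & all (fun v => valency v == 3%N) (map terminus p)].

Definition disjoint_edges (e f : edge L) : bool :=
  [disjoint [set src e; tgt e] & [set src f; tgt f]].

Definition delete_edges (D : {set edge L}) : mgraph R :=
  @MGraph R (vert L) {e : edge L | e \notin D}
    (fun e => src (val e)) (fun e => tgt (val e)) (fun e => len (val e))
    (fun e => len_gt0 (val e)).

End MetricGraph.

Arguments Phi {R} L.

(* The Fano plane: points and lines are numbered by Z/7, and the line l
   consists of the points l, l + 1, l + 3. *)
Definition incident (p l : 'I_7) : bool :=
  val p \in [seq ((l + k) %% 7)%N | k <- [:: 0; 1; 3]%N].

Lemma fano_line (p q : 'I_7) :
  p != q -> exists! l : 'I_7, incident p l && incident q l.
Proof.
pose inc (p l : nat) := p \in [seq ((l + k) %% 7)%N | k <- [:: 0; 1; 3]%N].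
have H : all (fun p => all (fun q => (p != q) ==>
    has (fun l => [&& inc p l, inc q l & all (fun l' => inc p l' && inc q l' ==>
    (l == l')) (iota 0 7)]) (iota 0 7)) (iota 0 7)) (iota 0 7) by vm_compute.
have I7 (i : 'I_7) : val i \in iota 0 7 by rewrite mem_iota ltn_ord.
move=> pq; have /implyP/(_ pq) := allP (allP H _ (I7 p)) _ (I7 q).
move=> /hasP[l]; rewrite mem_iota => /andP[_ l7] /and3P[pl ql /allP u].
exists (Ordinal l7); split=> [|l' pql']; first by apply/andP.
by apply/val_inj/eqP; have /implyP := u _ (I7 l'); apply.
Qed.

Lemma fano_line_card (l : 'I_7) : #|[set p | incident p l]| = 3%N.
Proof.
rewrite -sum1dep_card big_mkcond /= !big_ord_recl big_ord0.
by case: l => [[|[|[|[|[|[|[|l]]]]]]] //] ?; vm_compute.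
Qed.

Definition flag : finType := {f : 'I_7 * 'I_7 | incident f.1 f.2}.

Lemma third_pi_gt0 (R : realType) : 0 < (pi / 3 : R).
Proof. by rewrite divr_gt0 ?pi_gt0. Qed.

Definition fano_graph (R : realType) : mgraph R :=
  @MGraph R ('I_7 + 'I_7)%type flag
    (fun f => inl (val f).1) (fun f => inr (val f).2) (fun=> pi / 3)
    (fun=> third_pi_gt0 R).

Definition three_disjoint (R : realType) (D : {set edge (fano_graph R)}) :=
  #|D| = 3%N /\ {in D &, forall e f, e != f -> disjoint_edges e f}.

(* G is obtained from the incidence graph of the Fano plane by deleting three
   disjoint edges. *)
Definition three_missing (R : realType) (G : mgraph R) : Prop :=
  exists2 D : {set edge (fano_graph R)}, three_disjoint D
    & G = delete_edges D.

Section SixGraphs.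
Variables (R : realType) (G : mgraph R).

Definition is_G1 : Prop := three_missing G /\
  nonbranching_lengths G (nseq 9 (pi / 3) ++ nseq 3 pi).
Definition is_G2 : Prop := three_missing G /\
  nonbranching_lengths G
    (nseq 8 (pi / 3) ++ nseq 2 (2 * pi / 3) ++ nseq 2 pi).
Definition is_G3 : Prop := three_missing G /\
  nonbranching_lengths G
    (nseq 8 (pi / 3) ++ nseq 3 (2 * pi / 3) ++ nseq 1 (4 * pi / 3)).
Definition is_G4 : Prop := three_missing G /\
  nonbranching_lengths G
    (nseq 7 (pi / 3) ++ nseq 4 (2 * pi / 3) ++ nseq 1 pi).
Definition is_G5 : Prop := [/\ three_missing G,
  nonbranching_lengths G (nseq 6 (pi / 3) ++ nseq 6 (2 * pi / 3))
  & has_branching_6cycle G].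
Definition is_G6 : Prop := [/\ three_missing G,
  nonbranching_lengths G (nseq 6 (pi / 3) ++ nseq 6 (2 * pi / 3))
  & ~ has_branching_6cycle G].

End SixGraphs.

(* Main.v *)
(* Cut a path of Phi at its vertices. Since it is injective and leaves a vertex,
   it cannot turn back inside an edge, so for edges of length pi/3 the elements
   of Phi are the walks of three edges without repeated vertex that start at a
   vertex of valency 3. The rank of a graph G is therefore T / (2 P), where P
   counts these walks and T adds up, over all of them, one plus the number of
   such walks with the same endpoints. The numbers n1 and n2 of maximal
   non-branching paths of lengths pi/3 and 2 pi/3 count walks as well. There are
   644 triples of disjoint edges in the Fano incidence graph, and evaluating
   (n1, n2, P, T) for each of them shows that n1 and n2 determine P and T. *)
Require Import Defs.
From mathcomp Require Import all_boot all_order all_algebra.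
From mathcomp Require Import finmap.
From mathcomp Require Import all_classical all_reals all_analysis.
From mathcomp Require Import ring lra.

Set Implicit Arguments.
Unset Strict Implicit.
Unset Printing Implicit Defensive.

Import Order.TTheory GRing.Theory Num.Theory.

Local Open Scope ring_scope.

(** * Paths along walks *)

Section Paths.
Variables (R : realType) (L : mgraph R).
Implicit Types (v w : vert L) (d : dart L) (p q : seq (dart L)).

(** [chart] measured in the direction of travel: [t] is the time since leaving [origin d], also when
    the edge is run backwards. *)
Definition dchart d (t : R) : mpoint L :=
  chart d.1 (if d.2 then len d.1 - t else t).

Lemma dchart0 d : dchart d 0 = inl (origin d).
Proof.
rewrite /dchart /chart /origin; case: d => e [] /=; last by rewrite eqxx.
by rewrite subr0 gt_eqF ?len_gt0 // eqxx.
Qed.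

Lemma dchart_len d : dchart d (len d.1) = inl (terminus d).
Proof.
rewrite /dchart /chart /terminus; case: d => e [] /=; first by rewrite subrr eqxx.
by rewrite gt_eqF ?len_gt0 // eqxx.
Qed.

Lemma dchart_int d t : 0 < t < len d.1 ->
  dchart d t = inr (d.1, if d.2 then len d.1 - t else t).
Proof.
move=> /andP[t0 tl]; rewrite /dchart /chart; case: d.2.
  by rewrite subr_eq0 (gt_eqF tl) -subr_eq0 addrAC subrr sub0r oppr_eq0 (gt_eqF t0).
by rewrite (gt_eqF t0) (lt_eqF tl).
Qed.

Lemma dchart_inj d x y : origin d != terminus d ->
  0 <= x -> x < y -> y <= len d.1 -> dchart d x <> dchart d y.
Proof.
move=> ot; rewrite le_eqVlt => /predU1P[<-|x0] xy; rewrite le_eqVlt => /predU1P[yl|yl].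
- by rewrite yl dchart0 dchart_len => -[] /eqP; rewrite (negPf ot).
- by rewrite dchart0 dchart_int ?xy.
- by rewrite yl dchart_len dchart_int // x0 -yl.
rewrite !dchart_int ?x0 ?(lt_trans xy) ?(lt_trans x0) // => -[].
by case: d.2; lra.
Qed.

Lemma walk_cons v d p :
  walk v (d :: p) = (origin d == v) && walk (terminus d) p.
Proof. by rewrite /walk /= eqseq_cons. Qed.

Lemma walk_cat v p q :
  walk v (p ++ q) = walk v p && walk (last v (map (@terminus _ L) p)) q.
Proof. by elim: p v => //= d p IH v; rewrite !walk_cons IH andbA. Qed.

Lemma walk_mem v p d : walk v p -> d \in p ->
  origin d \in v :: map (@terminus _ L) p /\ terminus d \in map (@terminus _ L) p.
Proof.
elim: p v => // c p IH v; rewrite walk_cons => /andP[/eqP cv wp].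
rewrite in_cons => /predU1P[->|dp]; first by rewrite -cv /= !mem_head.
by have [dl dr] := IH _ wp dp; split; rewrite /= in_cons ?dl ?dr orbT.
Qed.

Lemma walk_length_nil : @walk_length R L [::] = 0.
Proof. by rewrite /walk_length big_nil. Qed.

Lemma walk_length_cons d p : walk_length (d :: p) = len d.1 + walk_length p.
Proof. by rewrite /walk_length big_cons. Qed.

Lemma walk_length_cat p q : walk_length (p ++ q) = walk_length p + walk_length q.
Proof. by rewrite /walk_length big_cat. Qed.

Lemma walk_length_ge0 p : 0 <= walk_length p.
Proof. by apply: sumr_ge0 => d _; apply/ltW/len_gt0. Qed.

(** At a junction time the earlier edge supplies the value; for walks the later edge gives the same
    point. After the end the value stays at the last vertex. *)
Fixpoint wpath v p (x : R) : mpoint L :=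
  if p is d :: q then
    if x <= len d.1 then dchart d x else wpath (terminus d) q (x - len d.1)
  else inl v.

Lemma wpath0 v p : walk v p -> wpath v p 0 = inl v.
Proof.
case: p => // d p; rewrite walk_cons => /andP[/eqP <- _] /=.
by rewrite ltW ?len_gt0 // dchart0.
Qed.

Lemma wpath_tail v d p x : walk v (d :: p) -> 0 <= x ->
  wpath v (d :: p) (len d.1 + x) = wpath (terminus d) p x.
Proof.
rewrite walk_cons => /andP[_ wp] /=; rewrite le_eqVlt => /predU1P[<-|x0].
  by rewrite addr0 lexx dchart_len wpath0.
by rewrite gerDl leNgt x0 addrAC subrr add0r.
Qed.

Lemma wpath_catl v p q x : walk v (p ++ q) -> 0 <= x <= walk_length p ->
  wpath v (p ++ q) x = wpath v p x.
Proof.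
elim: p v x => [|d p IH] v x.
  by rewrite walk_length_nil -eq_le /= => wq /eqP<-; rewrite wpath0.
rewrite cat_cons walk_cons walk_length_cons => /andP[_ wpq] /andP[x0 xl] /=.
by case: leP => // dx; apply: IH => //; lra.
Qed.

Lemma wpath_catr v p q x : walk v (p ++ q) -> 0 <= x ->
  wpath v (p ++ q) (walk_length p + x) = wpath (last v (map (@terminus _ L) p)) q x.
Proof.
elim: p v => [|d p IH] v wpq x0; first by rewrite walk_length_nil add0r.
rewrite cat_cons walk_length_cons -addrA wpath_tail ?addr_ge0 ?walk_length_ge0 //.
by move: wpq; rewrite cat_cons walk_cons => /andP[_ /IH->].
Qed.

Lemma wpath_end v p : walk v p ->
  wpath v p (walk_length p) = inl (last v (map (@terminus _ L) p)).
Proof. by move=> wp; have := @wpath_catr v p [::] 0; rewrite cats0 addr0; apply. Qed.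

Lemma wpath_piece v p d q x : walk v (p ++ d :: q) -> 0 <= x <= len d.1 ->
  wpath v (p ++ d :: q) (walk_length p + x) = dchart d x.
Proof. by move=> wp /andP[x0 xl]; rewrite wpath_catr //= xl. Qed.

Lemma wpath_vertex v p w x : walk v p -> 0 < x <= walk_length p ->
  wpath v p x = inl w -> w \in map (@terminus _ L) p.
Proof.
elim: p v x => [|d p IH] v x.
  by rewrite walk_length_nil => _ /andP[] /lt_le_trans/[apply]; rewrite ltxx.
rewrite walk_cons walk_length_cons => /andP[_ wp] /andP[x0 xl] /=.
have [|dx] := leP x (len d.1); last first.
  by move=> /(IH _ _ wp) wq; rewrite in_cons wq ?orbT//; lra.
rewrite le_eqVlt => /predU1P[->|xd]; first by rewrite dchart_len => -[->]; rewrite mem_head.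
by rewrite dchart_int // x0.
Qed.

Lemma wpath_edge v p e t x : 0 <= x -> wpath v p x = inr (e, t) ->
  e \in [seq d.1 | d <- p].
Proof.
elim: p v x => // d p IH v x x0 /=.
have [xd|dx] := leP x (len d.1); last by move=> /IH eq; rewrite in_cons eq ?orbT// subr_ge0 ltW.
by rewrite /dchart /chart; do 2! case: ifP => // _; case=> -> _; rewrite mem_head.
Qed.

(** Induction on the walk; the new case has [x] on the first edge and [y] beyond it. A coincidence
    at [x = 0] makes the walk return to [v]; one inside the edge makes it run that edge again, which
    also brings it back to [v]. *)
Lemma wpath_inj v p x y : walk v p -> uniq (v :: map (@terminus _ L) p) ->
  0 <= x -> x < y -> y <= walk_length p -> wpath v p x <> wpath v p y.
Proof.
elim: p v x y => [|d p IH] v x y.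
  rewrite walk_length_nil => _ _ x0 /(le_lt_trans x0) /lt_le_trans/[apply].
  by rewrite ltxx.
move=> wdp; have := wdp; rewrite walk_cons walk_length_cons.
move=> /andP[/eqP dv wp]; rewrite map_cons => uv.
have /andP[vp up] := uv.
move=> x0 xy yl; have [yd|dy] := leP y (len d.1).
  rewrite /= yd (ltW (lt_le_trans xy yd)); apply: dchart_inj => //.
  by apply: contraNneq vp => <-; rewrite dv mem_head.
have [dx|xd] := leP (len d.1) x.
  rewrite -(subrK (len d.1) x) -(subrK (len d.1) y) ![_ + len d.1]addrC.
  by rewrite !wpath_tail//; [apply: IH => //|..]; lra.
rewrite -(subrK (len d.1) y) [_ + len d.1]addrC wpath_tail //; last by lra.
rewrite /= (ltW xd); move: x0; rewrite le_eqVlt => /predU1P[<-|x0].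
  rewrite dchart0 dv => /esym /wpath_vertex vt; case/negP: vp.
  by rewrite in_cons vt ?orbT //; lra.
rewrite dchart_int ?x0 // => /esym /wpath_edge => /(_ ltac:(lra)) /mapP[c cp dc].
have [oc tc] := walk_mem wp cp.
have: v \in [:: origin c; terminus c].
  by rewrite -dv /origin /terminus dc !inE; case: d.2; case: c.2; rewrite /= eqxx ?orbT.
by rewrite !inE => /orP[] /eqP vE; case/negP: vp; rewrite vE // in_cons tc orbT.
Qed.

Definition mktime (x : R) (x0pi : 0 <= x <= pi) : time R := exist _ x x0pi.

Definition wtime v p : time R -> mpoint L := fun x => wpath v p (val x).

Lemma wtime_unit_speed v p : walk v p -> walk_length p = pi ->
  unit_speed (wtime v p).
Proof.
move=> wp lp; exists (size p), (fun i => walk_length (take i p)); split.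
- by rewrite take0 walk_length_nil.
- by rewrite take_size.
- case: p {wp lp} => // d0 p i ip; rewrite (take_nth d0) // -cats1 walk_length_cat.
  by rewrite lerDl walk_length_ge0.
case: p wp lp => // d0 p0; set p := d0 :: p0 => wp lp i ip.
set d := nth d0 p i; set W := walk_length (take i p).
(* The edge is entered at time [W]; run backwards, its parameter starts at [len d.1] and
   decreases. *)
exists d.1, (if d.2 then len d.1 + W else - W), d.2 => x /=.
have -> : walk_length (take i.+1 p) = W + len d.1.
  by rewrite (take_nth d0) // -cats1 walk_length_cat walk_length_cons walk_length_nil addr0.
move=> /andP[Wx xW]; split; first by case: d.2; rewrite ?expr1 ?expr0; lra.
have pE : p = take i p ++ d :: drop i.+1 p by rewrite -drop_nth // cat_take_drop.
have wp' : walk v (take i p ++ d :: drop i.+1 p) by rewrite -pE.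
have xd : 0 <= sval x - W <= len d.1 by lra.
have := wpath_piece wp' xd; rewrite -pE -/W subrKC /wtime /= => ->.
by rewrite /dchart; congr chart; case: d.2; rewrite ?expr1 ?expr0; ring.
Qed.

Lemma wtime_injective v p : walk v p -> walk_length p = pi ->
  uniq (v :: map (@terminus _ L) p) -> injective (wtime v p).
Proof.
move=> wp lp up x y; case: (ltgtP (val x) (val y)) => [||/val_inj//].
  move=> xy xyE; case: (wpath_inj wp up _ xy _ xyE); rewrite ?lp.
    by case/andP: (valP x).
  by case/andP: (valP y).
move=> xy /esym xyE; case: (wpath_inj wp up _ xy _ xyE); rewrite ?lp.
  by case/andP: (valP y).
by case/andP: (valP x).
Qed.

(** The vertices are visited at the lengths of the initial segments, which strictly increase, so a
    repeated vertex would be a point visited at two times. *)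
Lemma wtime_uniq v p : walk v p -> walk_length p = pi -> injective (wtime v p) ->
  uniq (v :: map (@terminus _ L) p).
Proof.
move=> wp lp inj.
have tm i : 0 <= walk_length (take i p) <= pi.
  by rewrite -lp -{3}(cat_take_drop i p) walk_length_cat walk_length_ge0 lerDl walk_length_ge0.
have nthE i : (i <= size p)%N ->
    wtime v p (mktime (tm i)) = inl (nth v (v :: map (@terminus _ L) p) i).
  move=> ip; rewrite /wtime /=.
  have wt := wp; rewrite -(cat_take_drop i p) in wt.
  rewrite -{1}(cat_take_drop i p) wpath_catl ?walk_length_ge0 ?lexx //.
  rewrite wpath_end; last by move: wt; rewrite walk_cat => /andP[].
  rewrite (last_nth v) size_map size_takel // map_take.
  by case: i ip {wt} => //= i ip; rewrite nth_take.
apply/(uniqP v) => i j; rewrite !inE /= size_map !ltnS => ip jp ijE.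
have lt_len (a b : nat) : (b <= size p)%N -> (a < b)%N ->
    walk_length (take a p) < walk_length (take b p).
  move=> bp ab; rewrite -(subnKC ab) addSnnS takeD.
  rewrite walk_length_cat ltrDl; case: p bp {wp lp inj tm nthE ip jp ijE} => [|c p'].
    by case: b ab.
  move=> bp; rewrite (drop_nth c) /= ?walk_length_cons.
    by rewrite ltr_pwDl ?len_gt0 ?walk_length_ge0.
  exact: leq_trans bp.
have /inj/(congr1 val) /= E : wtime v p (mktime (tm i)) = wtime v p (mktime (tm j)).
  by rewrite !nthE // ijE.
by case: (ltngtP i j) => // [/(lt_len _ _ jp)|/(lt_len _ _ ip)]; rewrite E ltxx.
Qed.

End Paths.

(** * Every path follows a walk *)

Section Existence.
Variables (R : realType) (L : mgraph R).
Implicit Types (v w : vert L) (d : dart L) (p q : seq (dart L)).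

Lemma chart_vertex (e : edge L) t w : chart e t = inl w ->
  t = 0 /\ w = src e \/ t = len e /\ w = tgt e.
Proof.
rewrite /chart; case: eqP => [-> [->]|_]; first by left.
by case: eqP => // -> [->]; right.
Qed.

Lemma chart_interior (e f : edge L) t s : chart e t = inr (f, s) -> e = f /\ t = s.
Proof. by rewrite /chart; do 2! case: ifP => // _; case. Qed.

Variables (alpha : time R -> mpoint L) (v : vert L).

(* The last condition makes [p] minimal: its last edge is entered before [s]. *)
Definition follows p s : Prop :=
  [/\ walk v p, forall x, sval x <= s -> alpha x = wpath v p (sval x),
      s <= walk_length p & forall q d, p = rcons q d -> walk_length q < s].

Lemma wpath_rcons_last p d x : walk v (rcons p d) ->
  walk_length p <= x <= walk_length p + len d.1 ->
  wpath v (rcons p d) x = dchart d (x - walk_length p).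
Proof.
rewrite -cats1 => wp /andP[px xp].
have xd : 0 <= x - walk_length p <= len d.1 by lra.
by have := wpath_piece wp xd; rewrite subrKC.
Qed.

Lemma walk_length_rcons p d : walk_length (rcons p d) = walk_length p + len d.1.
Proof. by rewrite -cats1 walk_length_cat walk_length_cons walk_length_nil addr0. Qed.

(** At time [a] the path is either at the end of the walk, where the next edge is appended, or
    strictly inside the last edge. Then the new piece lies on that same edge, and injectivity forces
    it to keep the direction. *)
Lemma follows_extend p a b (e : edge L) c (back : bool) : injective alpha ->
  0 <= a -> a < b -> b <= pi -> follows p a ->
  (forall x : time R, a <= sval x <= b -> let t := c + (-1) ^+ back * sval x in
     0 <= t <= len e /\ alpha x = chart e t) ->
  exists p', follows p' b.
Proof.
move=> inj a0 ab bpi [wp pa ap pq] run.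
have api : 0 <= a <= pi by lra.
have bpi' : 0 <= b <= pi by lra.
have [|/= ta aE] := run (mktime api); first by rewrite /= lexx ltW.
have [|/= tb _] := run (mktime bpi'); first by rewrite /= lexx ltW.
have {}aE : wpath v p a = chart e (c + (-1) ^+ back * a) by rewrite -aE pa //=.
move: ap; rewrite le_eqVlt => /predU1P[ap|ap].
  (* At a vertex the parameter is an end of [[0, len e]]; as the piece has positive duration and
     stays in this interval, it is the end from which the motion starts. *)
  have tE : c + (-1) ^+ back * a = if back then len e else 0.
    move: aE; rewrite ap wpath_end // -ap => /esym/chart_vertex.
    by case: back {run} ta tb => /=; rewrite ?expr1 ?expr0 => ta tb [][]; lra.
  have eE : last v (map (@terminus _ L) p) = origin (e, back).
    move: aE; rewrite tE ap wpath_end // /origin /=.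
    by case: back {run ta tb tE}; rewrite /chart ?eqxx ?gt_eqF ?len_gt0 // => -[->].
  have wp' : walk v (rcons p (e, back)).
    by rewrite -cats1 walk_cat wp walk_cons eE eqxx.
  have bE : b <= walk_length p + len e.
    by case: back {run aE eE wp'} ta tb tE => /=; rewrite ?expr1 ?expr0; lra.
  exists (rcons p (e, back)); split=> //.
  - move=> x xb; have [xa|ax] := leP (sval x) a.
      rewrite pa // -cats1 wpath_catl ?cats1 // -ap xa andbT.
      by case/andP: (valP x).
    rewrite wpath_rcons_last /=; [|by []|lra].
    have [|_ ->] := run x; first by rewrite ltW.
    rewrite /dchart /= -ap; congr chart.
    by case: back {run aE eE wp'} ta tb tE => /=; rewrite ?expr1 ?expr0; lra.
  - by rewrite walk_length_rcons.
  - by move=> q d /rcons_inj[<- _]; rewrite -ap.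
case/lastP: p => [|q d] in wp pa ap pq aE *.
  by move: ap; rewrite walk_length_nil ltNge a0.
have qa := pq q d erefl; rewrite walk_length_rcons in ap.
move: aE; rewrite wpath_rcons_last ?dchart_int //; [|lra..].
move=> /esym/chart_interior[eE taE]; rewrite {}eE in run ta tb taE.
have [bE|bE] := eqVneq back d.2.
  have bW : b <= walk_length q + len d.1.
    by case: d.2 bE taE ta tb => -> /=; rewrite ?expr1 ?expr0; lra.
  exists (rcons q d); split=> //.
  - move=> x xb; have [xa|ax] := leP (sval x) a; first by rewrite pa.
    rewrite wpath_rcons_last //; [|lra].
    have [|_ ->] := run x; first by rewrite ltW.
    rewrite /dchart; congr chart.
    by case: d.2 bE taE => -> /=; rewrite ?expr1 ?expr0; lra.
  - by rewrite walk_length_rcons.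
  - by move=> q' d' /rcons_inj[<- _]; exact: lt_trans ab.
(* Otherwise the path turns back at time [a] inside the edge. *)
pose eps := Num.min (b - a) (a - walk_length q).
have eps0 : 0 < eps by rewrite lt_min !subr_gt0 ab.
have epsb : a + eps <= b by rewrite -lerBrDl ge_min lexx.
have epsq : walk_length q <= a - eps by rewrite lerBrDl -lerBrDr ge_min lexx orbT.
have q0 := walk_length_ge0 q.
have xpi : 0 <= a - eps <= pi by lra.
have ypi : 0 <= a + eps <= pi by lra.
exfalso; suff aE : alpha (mktime xpi) = alpha (mktime ypi).
  have : a - eps = a + eps := congr1 sval (inj _ _ aE).
  lra.
rewrite pa /=; last by lra.
have [|_ ->] := run (mktime ypi); first by rewrite /=; lra.
rewrite wpath_rcons_last //=; last by lra.
rewrite /dchart; congr chart.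
by case: d.2 back bE taE {run ta tb} => -[] //= _; rewrite ?expr1 ?expr0; lra.
Qed.

(** Induction on the cuts. Minimality of the walk obtained at the last cut, [pi], yields the strict
    bound: without its last edge it is shorter than [pi]. *)
Lemma unit_speed_walk : unit_speed alpha -> injective alpha ->
  alpha (time0 R) = inl v ->
  exists q d, [/\ walk v (rcons q d), alpha = wtime v (rcons q d)
    & walk_length q < pi <= walk_length q + len d.1].
Proof.
move=> [n [cut [cut0 cutn cutS run]]] inj alpha0.
have cut_pi k : (k <= n)%N -> cut (n - k)%N <= pi.
  elim: k => [|k IH] kn; first by rewrite subn0 cutn.
  apply: le_trans (IH (ltnW kn)); rewrite -[leRHS](congr1 cut (subnSK kn)).
  by apply: cutS; rewrite subnSK // leq_subr.
have P i : (i <= n)%N -> 0 <= cut i /\ exists p, follows p (cut i).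
  elim: i => [_|i IH i_n].
    rewrite cut0; split=> //; exists [::]; split=> //.
    - move=> x x0; rewrite /= -alpha0; congr alpha; apply/val_inj/le_anti.
      by rewrite /= x0; case/andP: (valP x).
    - by rewrite walk_length_nil.
    - by case.
  have [c0 [p fp]] := IH (ltnW i_n).
  have cc := cutS i i_n; split; first exact: le_trans cc.
  (* Cuts may coincide; an interval reduced to a point leaves the walk as it is. *)
  move: cc; rewrite le_eqVlt => /predU1P[<-|cc]; first by exists p.
  have [e [c [back H]]] := run i i_n.
  apply: (@follows_extend p (cut i) (cut i.+1) e c back) => //.
  by rewrite -(subKn i_n) cut_pi // leq_subr.
have [_ [p [wp pa pip pq]]] := P n (leqnn n); rewrite cutn in pa pip pq.
case/lastP: p => [|q d] in wp pa pip pq *.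
  by move: pip; rewrite walk_length_nil leNgt pi_gt0.
exists q, d; split=> //; last by rewrite -walk_length_rcons pip (pq q d).
by apply/funext => x; rewrite pa //; case/andP: (valP x).
Qed.

End Existence.

(** * Edges of length pi/3 *)

(** An explicit enumeration proves finiteness, so that [fset_set] does not take its default value,
    and then replaces it in sums and cardinals. *)
Lemma fset_set_perm (T : choiceType) (A : set T) (s : seq T) :
  uniq s -> (forall x, A x <-> x \in s) -> perm_eq (fset_set A) s.
Proof.
move=> us As; have Afin : finite_set A.
  by apply/finite_seqP; exists s; apply/seteqP; split=> x /As.
apply: uniq_perm => // x; rewrite in_fset_set //; apply/idP/idP; last by move=> /As; rewrite inE.
by rewrite inE => /As.
Qed.

Section EqualLengths.
Variables (R : realType) (L : mgraph R).
Implicit Types (v w : vert L) (d : dart L) (p q : seq (dart L)).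

Hypothesis len_third : forall e : edge L, len e = pi / 3.

Lemma walk_length_third p : walk_length p = (size p)%:R * (pi / 3).
Proof.
elim: p => [|d p IH]; first by rewrite walk_length_nil mul0r.
by rewrite walk_length_cons IH len_third /= -[(size p).+1%:R]natr1; ring.
Qed.

Lemma walk_length3 (p : 3.-tuple (dart L)) : walk_length p = pi.
Proof. by rewrite walk_length_third size_tuple; field. Qed.

Lemma wpath_eq v w p q : walk v p -> walk w q -> size p = size q ->
  (forall x : R, 0 <= x <= walk_length p -> wpath v p x = wpath w q x) -> p = q.
Proof.
elim: p v w q => [|d p IH] v w [|c q] //.
move=> wp wq [pq] E; have pi3 := third_pi_gt0 R.
have p0 := walk_length_ge0 p; rewrite walk_length_cons len_third in E.
have dc : d = c.
  (* The point one third of the way along the first edge is interior, so it determines the edge, and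
     is not the midpoint, so it determines the direction. *)
  have x3 : 0 <= (pi / 3 / 3 : R) <= pi / 3 + walk_length p by lra.
  have x3' : (pi / 3 / 3 : R) <= pi / 3 by lra.
  have := E _ x3; rewrite /= !len_third x3'.
  rewrite !dchart_int ?len_third; [|lra|lra].
  case=> de tE; rewrite [d]surjective_pairing [c]surjective_pairing de.
  by move: tE; case: d.2; case: c.2 => // tE; exfalso; clear -pi3 tE; lra.
rewrite -dc in wq E *; congr (_ :: _); have wdp := wp; have wdq := wq.
move: wp wq; rewrite !walk_cons => /andP[_ wp] /andP[_ wq].
apply: (IH _ _ _ wp wq pq) => x xp; have /andP[x0 _] := xp.
by rewrite -(wpath_tail wdp x0) -(wpath_tail wdq x0); apply: E; rewrite len_third; lra.
Qed.

Definition short_walk v (p : 3.-tuple (dart L)) :=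
  walk v p && uniq (v :: map (@terminus _ L) p).

Lemma wtime0 v p : walk v p -> wtime v p (time0 R) = inl v.
Proof. by move=> wp; rewrite /wtime /= wpath0. Qed.

Lemma wtime_pi v (p : 3.-tuple (dart L)) : walk v p ->
  wtime v p (timepi R) = inl (last v (map (@terminus _ L) p)).
Proof. by move=> wp; rewrite /wtime /= -(walk_length3 p) wpath_end. Qed.

Lemma wtime_eq v w (p q : 3.-tuple (dart L)) : walk v p -> walk w q ->
  wtime v p = wtime w q -> v = w /\ p = q.
Proof.
move=> wp wq E; split.
  by have := congr1 (fun f => f (time0 R)) E; rewrite !wtime0 // => -[].
apply/val_inj/(wpath_eq wp wq); first by rewrite !size_tuple.
by rewrite walk_length3 => x x0pi; have := congr1 (fun f => f (mktime x0pi)) E.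
Qed.

Lemma PhiP alpha : Phi L alpha <->
  exists v (p : 3.-tuple (dart L)), [/\ short_walk v p, (3 <= valency v)%N & alpha = wtime v p].
Proof.
split=> [[us inj [v [a0 v3]]]|[v [p [/andP[wp up] v3 ->]]]]; last first.
  split; first exact: wtime_unit_speed (walk_length3 _).
    exact: wtime_injective (walk_length3 _) _.
  by exists v; rewrite wtime0.
have [q [d [wp aE]]] := unit_speed_walk us inj a0.
rewrite walk_length_third len_third => /andP[qlt qge].
(* The bounds [size q * pi / 3 < pi <= (size q + 1) * pi / 3] leave only [size q = 2]. *)
have sq : size (rcons q d) == 3%N.
  have q2 : (size q < 3)%N.
    by rewrite -(ltr_nat R) -(ltr_pM2r (third_pi_gt0 R)) (lt_le_trans qlt) //; lra.
  have q3 : (3 <= (size q).+1)%N.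
    by rewrite -(ler_nat R) -(ler_pM2r (third_pi_gt0 R)) -[(size q).+1%:R]natr1 mulrDl; lra.
  by rewrite size_rcons eqn_leq q2 q3.
exists v, (Tuple sq); split=> //; rewrite /short_walk wp /=.
apply: wtime_uniq => //; first exact: walk_length3 (Tuple sq).
by rewrite -aE.
Qed.

Definition short_walks v : {set 3.-tuple (dart L)} := [set p | short_walk v p].

Lemma Phi_perm : perm_eq (fset_set (Phi L))
  [seq wtime v p | v <- enum [pred v | (3 <= valency v)%N],
                   p : 3.-tuple (dart L) <- enum (short_walks v)].
Proof.
apply: fset_set_perm.
  apply: allpairs_uniq_dep => [|v _|]; rewrite ?enum_uniq //.
  move=> _ _ /allpairsPdep[v [p [_ pv ->]]] /allpairsPdep[w [q [_ qw ->]]] /=.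
  move: pv qw; rewrite !mem_enum !inE => /andP[wp _] /andP[wq _].
  by move=> /(wtime_eq wp wq)[-> ->].
move=> alpha; rewrite PhiP; split.
  move=> [v [p [sp v3 ->]]]; apply/allpairsPdep; exists v, p.
  by rewrite !mem_enum !inE.
by move=> /allpairsPdep[v [p [+ + ->]]]; rewrite !mem_enum !inE; exists v, p.
Qed.

(** The successor counts the path itself, which [coterminal] excludes and the set on the right
    contains. *)
Lemma coterminal_card v (p : 3.-tuple (dart L)) :
  short_walk v p -> (3 <= valency v)%N ->
  #|` fset_set (coterminal (wtime v p))|.+1 =
  #|[set q in short_walks v | last v (map (@terminus _ L) q) == last v (map (@terminus _ L) p)]|.
Proof.
move=> sp v3; set A := [set q in _ | _].
have pA : p \in A by rewrite !inE sp eqxx.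
rewrite (cardsD1 p) pA add1n; congr _.+1.
rewrite cardE -(size_map (fun q : 3.-tuple _ => wtime v q)).
apply/perm_size/fset_set_perm.
  rewrite map_inj_in_uniq ?enum_uniq // => q r.
  rewrite !mem_enum !inE => /and3P[_ /andP[wq _] _] /and3P[_ /andP[wr _] _].
  by move=> /(wtime_eq wq wr)[].
have wp : walk v p by case/andP: sp.
move=> alpha; split.
  move=> [/PhiP[w [q [sq w3 ->]]] qp].
  have wq : walk w q by case/andP: sq.
  rewrite !wtime0 ?wtime_pi // => -[wv]; rewrite {}wv in sq qp wq *.
  move=> -[qpE]; apply: map_f; rewrite mem_enum !inE sq qpE eqxx !andbT.
  by apply: contra_notN qp => /eqP->.
move=> /mapP[q]; rewrite mem_enum !inE => /and3P[qp sq /eqP qpE] ->.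
have wq : walk v q by case/andP: sq.
split; rewrite ?wtime0 ?wtime_pi ?qpE //; first by apply/PhiP; exists v, q.
by move=> /(wtime_eq wq wp)[_ /eqP]; rewrite (negPf qp).
Qed.

(** At a vertex of valency 3 one has [q = 2], so a path with [N] companions has rank
    [1 + N / 2 = ((N + 1) + 1) / 2], where [N + 1] is the cardinal of [coterminal_card]. *)
Lemma cat0_rankE : (forall v, valency v <= 3)%N -> cat0_rank L =
  (\sum_(v | valency v == 3) \sum_(p in short_walks v)
    #|[set q in short_walks v | last v (map (@terminus _ L) q)
                             == last v (map (@terminus _ L) p)]|.+1)%:R
  / (2 * \sum_(v | valency v == 3) #|short_walks v|)%:R.
Proof.
move=> val3; have v3E v : (3 <= valency v)%N = (valency v == 3%N).
  by rewrite eqn_leq val3.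
rewrite /cat0_rank (perm_big _ Phi_perm) (perm_size Phi_perm) size_allpairs_dep.
rewrite sumnE big_map /= big_enum /= big_allpairs_dep big_enum /=.
rewrite ![in LHS](eq_bigl _ _ v3E) natrM invfM mulrA; congr (_ / _%:R); last first.
  by apply: eq_bigr => v _; rewrite cardE.
rewrite natr_sum mulr_suml; apply: eq_bigr => v /eqP v3.
rewrite natr_sum mulr_suml big_enum /=; apply: eq_bigr => p; rewrite inE => sp.
have wp : walk v p by case/andP: sp.
rewrite -coterminal_card ?v3 // /path_rank wtime0 //= v3 -2!natr1 /=.
by rewrite !mulrDl -addrA -splitr addrC.
Qed.

(** A walk of [i] edges has length [i * pi / 3], so only the summand [i = k] can be nonzero. *)
Lemma nonbranching_multE k : (k < #|vert L|)%N ->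
  nonbranching_mult L (k%:R * (pi / 3)) =
  (\sum_(v : vert L) #|[set p : k.-tuple (dart L) | nonbranching v p]|)./2.
Proof.
move=> kn; rewrite /nonbranching_mult (bigD1 (Ordinal kn)) //= [X in (_ + X)%N]big1; last first.
  move=> i ik; apply/eqP; rewrite cards_eq0; apply/eqP/setP => -[v p].
  rewrite !inE /= walk_length_third size_tuple; apply/negbTE/nandP; right.
  apply: contra ik => /eqP/(mulIf (lt0r_neq0 (third_pi_gt0 R)))/eqP.
  by rewrite eqr_nat => /eqP ik; apply/eqP/val_inj.
rewrite addn0; congr _./2; rewrite [RHS](eq_bigr _ (fun v _ => esym (sum1dep_card _))).
rewrite pair_big_dep -sum1dep_card; apply: eq_bigl => -[v p] /=.
by rewrite walk_length_third size_tuple eqxx andbT.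
Qed.

End EqualLengths.

(** * Walks as lists of vertices *)

Section ListWalks.
Variables (T : eqType) (nbrs : T -> seq T) (vs : seq T).

(* A walk from [x] is given by the list of its vertices other than [x]. *)
Fixpoint walks k x : seq (seq T) :=
  if k is k'.+1 then [seq y :: s | y <- nbrs x, s <- walks k' y] else [:: [::]].

Definition simple_walks k x := [seq s <- walks k x | uniq (x :: s)].

Definition deg x := size (nbrs x).

Definition branching_ends x s :=
  [&& deg x == 3, deg (last x s) == 3
    & all (fun y => deg y == 2) (behead (belast x s))]%N.

Definition nonbranching_count k :=
  sumn [seq count (branching_ends x) (simple_walks k x) | x <- vs].

Definition geodesic_count :=
  sumn [seq size (simple_walks 3 x) | x <- vs & deg x == 3%N].

Definition endpoints x := [seq last x s | s <- simple_walks 3 x].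

(** An end occurs in [ends] once per walk reaching it, so each walk contributes [N + 2], twice the
    rank of its path. *)
Definition coterminal_count :=
  sumn [seq (let ends := endpoints x in sumn [seq (count_mem y ends).+1 | y <- ends])
       | x <- vs & deg x == 3%N].

Definition counts := (nonbranching_count 1, nonbranching_count 2,
  geodesic_count, coterminal_count).

Lemma walks_uniq k x : (forall y, uniq (nbrs y)) -> uniq (walks k x).
Proof.
move=> un; elim: k x => //= k IH x; apply: allpairs_uniq_dep => //.
by move=> [y s] [z t] _ _ /= [-> ->].
Qed.

End ListWalks.

(** * Invariance of the counts under relabelling of the vertices *)

Section Transport.
Variables (T T' : eqType) (f : T -> T') (nbrs : T -> seq T) (nbrs' : T' -> seq T').
Hypothesis f_inj : injective f.
Hypothesis nbrsE : forall x, nbrs' (f x) = map f (nbrs x).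

Lemma walks_map k x : walks nbrs' k (f x) = map (map f) (walks nbrs k x).
Proof.
elim: k x => //= k IH x; rewrite nbrsE.
elim: (nbrs x) => //= y s ->; rewrite map_cat IH -!map_comp.
by congr (_ ++ _); apply: eq_map.
Qed.

Lemma simple_walks_map k x :
  simple_walks nbrs' k (f x) = map (map f) (simple_walks nbrs k x).
Proof.
rewrite /simple_walks walks_map filter_map; congr map; apply: eq_filter => s.
by rewrite -[RHS](map_inj_uniq f_inj).
Qed.

Lemma deg_map x : deg nbrs' (f x) = deg nbrs x.
Proof. by rewrite /deg nbrsE size_map. Qed.

Lemma counts_map vs : counts nbrs' (map f vs) = counts nbrs vs.
Proof.
have nbE k : nonbranching_count nbrs' (map f vs) k = nonbranching_count nbrs vs k.
  rewrite /nonbranching_count -map_comp; congr sumn; apply: eq_map => x /=.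
  rewrite simple_walks_map count_map; apply: eq_count => s /=.
  rewrite /branching_ends last_map !deg_map; congr [&& _, _ & _].
  case: s => //= y s; rewrite belast_map all_map.
  by apply: eq_all => z /=; rewrite deg_map.
have degE : [seq x <- map f vs | deg nbrs' x == 3%N] =
    map f [seq x <- vs | deg nbrs x == 3%N].
  by rewrite filter_map; congr map; apply: eq_filter => x /=; rewrite deg_map.
rewrite /counts !nbE /geodesic_count /coterminal_count degE -!map_comp.
congr (_, _, _, _); congr sumn; apply: eq_map => x /=.
  by rewrite simple_walks_map size_map.
have -> : endpoints nbrs' (f x) = map f (endpoints nbrs x).
  by rewrite /endpoints simple_walks_map -!map_comp; apply: eq_map => s; apply: last_map.
rewrite -map_comp; congr sumn; apply: eq_map => y /=; congr _.+1.
by rewrite count_map; apply: eq_count => z /=; rewrite inj_eq.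
Qed.

End Transport.

(** * Walks in graphs without loops or parallel edges *)

Section SimpleGraph.
Variables (R : realType) (L : mgraph R) (vs : seq (vert L)).
Implicit Types (v w : vert L) (d : dart L) (p q : seq (dart L)).

Hypothesis vs_perm : perm_eq (index_enum (vert L)) vs.
(** Excludes parallel edges, and also loops, whose two darts have the same origin and terminus. *)
Hypothesis dart_inj : injective (fun d : dart L => (origin d, terminus d)).

Definition edge_rel v w := [exists d : dart L, (origin d == v) && (terminus d == w)].
Definition neighbours v := [seq w <- vs | edge_rel v w].

Lemma mem_neighbours v w : w \in neighbours v = edge_rel v w.
Proof. by rewrite mem_filter -(perm_mem vs_perm) mem_index_enum andbT. Qed.

Lemma neighbours_uniq v : uniq (neighbours v).
Proof. by rewrite filter_uniq // -(perm_uniq vs_perm) index_enum_uniq. Qed.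

(** Each incidence of an edge with [v] is a dart leaving [v], and [terminus] maps these darts
    bijectively onto the neighbours. *)
Lemma valency_deg v : valency v = deg neighbours v.
Proof.
have -> : valency v = #|[pred d : dart L | origin d == v]|.
  rewrite /valency -!sum1dep_card -sum1_card.
  rewrite [X in (X + _)%N]big_mkcond [X in (_ + X)%N]big_mkcond [RHS]big_mkcond.
  rewrite -[LHS]big_split /=.
  rewrite -(pair_bigA _ (fun e b => if origin (e, b) == v then 1 else 0)%N) /=.
  by apply: eq_bigr => e _; rewrite big_bool addnC.
rewrite /deg cardE -(size_map (@terminus R L)); apply/perm_size/uniq_perm.
- rewrite map_inj_in_uniq ?enum_uniq // => c d.
  by rewrite !mem_enum !inE => /eqP cv /eqP dv cd; apply: dart_inj; rewrite cv dv cd.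
- exact: neighbours_uniq.
move=> w; rewrite mem_neighbours; apply/mapP/existsP => -[d].
  by rewrite mem_enum inE => dv ->; exists d; rewrite dv eqxx.
by move=> /andP[dv /eqP<-]; exists d; rewrite ?mem_enum ?inE.
Qed.

Lemma walk_inj v p q : walk v p -> walk v q ->
  map (@terminus _ L) p = map (@terminus _ L) q -> p = q.
Proof.
elim: p v q => [|c p IH] v [|d q] //; rewrite !walk_cons.
move=> /andP[/eqP cv wp] /andP[/eqP dv wq] [cd pq].
have E : c = d by apply: dart_inj; rewrite cv dv cd.
by rewrite -E in wq *; rewrite (IH _ _ wp wq pq).
Qed.

Lemma mem_walks k v s : s \in walks neighbours k v <->
  exists p : k.-tuple (dart L), walk v p /\ s = map (@terminus _ L) p.
Proof.
elim: k v s => [|k IH] v s /=.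
  rewrite inE; split=> [/eqP->|[p [_ ->]]]; first by exists [tuple].
  by rewrite tuple0.
split=> [/allpairsPdep[w [t [+ /IH[p [wp ->]] ->]]]|[p [wp ->]]].
  rewrite mem_neighbours => /existsP[d /andP[dv /eqP dw]].
  by exists [tuple of d :: p]; rewrite walk_cons dv dw wp /= dw.
case/tupleP: p wp => d p; rewrite walk_cons => /andP[dv wp].
apply/allpairsPdep; exists (terminus d), (map (@terminus _ L) p); split=> //.
  by rewrite mem_neighbours; apply/existsP; exists d; rewrite dv eqxx.
by apply/IH; exists p.
Qed.

(** A walk is determined by its vertices, so counting tuples of darts amounts to counting lists of
    vertices. [Q] later selects the simple or the non-branching walks. *)
Lemma walks_perm v k (Q : pred (seq (vert L))) :
  perm_eq [seq map (@terminus _ L) p | p : k.-tuple (dart L) <-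
             enum [set p : k.-tuple (dart L) | walk v p && Q (map (@terminus _ L) p)]]
          [seq s <- walks neighbours k v | Q s].
Proof.
apply: uniq_perm.
- rewrite map_inj_in_uniq ?enum_uniq // => p q.
  rewrite !mem_enum !inE => /andP[wp _] /andP[wq _] /(walk_inj wp wq).
  exact: val_inj.
- by rewrite filter_uniq // walks_uniq //; exact: neighbours_uniq.
move=> s; rewrite mem_filter; apply/mapP/andP => [[p]|[Qs /mem_walks[p [wp sE]]]].
  by rewrite mem_enum inE => /andP[wp Qp] ->; split=> //; apply/mem_walks; exists p.
by exists p => //; rewrite mem_enum inE wp -sE.
Qed.

Lemma card_walks v k (Q : pred (seq (vert L))) :
  #|[set p : k.-tuple (dart L) | walk v p && Q (map (@terminus _ L) p)]| =
  count Q (walks neighbours k v).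
Proof. by rewrite -size_filter -(perm_size (walks_perm _ _ _)) size_map cardE. Qed.

Lemma card_short_walks v (Q : pred (seq (vert L))) :
  #|[set p in short_walks v | Q (map (@terminus _ L) p)]| =
  count Q (simple_walks neighbours 3 v).
Proof.
rewrite count_filter -card_walks; apply: eq_card => p.
by rewrite !inE /short_walk /= -andbA [Q _ && _]andbC.
Qed.

Lemma sum_short_walks v (F : seq (vert L) -> nat) :
  (\sum_(p in short_walks v) F (map (@terminus _ L) p))%N =
  sumn [seq F s | s <- simple_walks neighbours 3 v].
Proof.
rewrite -(perm_sumn (perm_map _ (walks_perm _ _ (fun s => uniq (v :: s))))).
by rewrite sumnE -map_comp big_map big_enum; apply: eq_bigl => p; rewrite !inE.
Qed.

Lemma sum_vs (P : pred (vert L)) (F : vert L -> nat) :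
  (\sum_(v | P v) F v)%N = sumn [seq F v | v <- vs & P v].
Proof. by rewrite (perm_big _ vs_perm) sumnE big_map big_filter. Qed.

Lemma counts_cat0_rank : (forall e : edge L, len e = pi / 3) ->
  (forall v, valency v <= 3)%N ->
  cat0_rank L = (coterminal_count neighbours vs)%:R
                / (2 * geodesic_count neighbours vs)%:R.
Proof.
move=> len3 val3; rewrite cat0_rankE //.
have degE : [pred v : vert L | valency v == 3%N] =1 (fun v => deg neighbours v == 3%N).
  by move=> v; rewrite /= valency_deg.
rewrite !sum_vs !(eq_filter degE); congr (_%:R / (2 * sumn _)%:R).
  congr sumn; apply: eq_map => v.
  rewrite /= /endpoints -map_comp -sum_short_walks; apply: eq_bigr => p _; congr _.+1.
  by rewrite count_map -card_short_walks.
apply: eq_map => v; rewrite -count_predT -card_short_walks.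
by apply: eq_card => p; rewrite !inE andbT.
Qed.

Lemma counts_nonbranching_mult k : (forall e : edge L, len e = pi / 3) ->
  (0 < k < #|vert L|)%N ->
  nonbranching_mult L (k%:R * (pi / 3)) = (nonbranching_count neighbours vs k)./2.
Proof.
move=> len3 /andP[k0 kn]; rewrite nonbranching_multE // sum_vs filter_predT.
congr (sumn _)./2; apply: eq_map => v; rewrite count_filter -card_walks.
apply: eq_card => p; rewrite !inE /nonbranching /branching_ends -!valency_deg.
(* Here [0 < k] enters: [nonbranching] asks for a nonempty walk. *)
have -> : (p != [::] :> seq _) by rewrite -size_eq0 size_tuple -lt0n.
rewrite (eq_all (fun w => congr1 (eq_op^~ 2%N) (esym (valency_deg w)))).
by rewrite /= -!andbA; do !bool_congr.
Qed.

End SimpleGraph.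

(** * Three disjoint edges of the Fano incidence graph *)

Section FanoCodes.
Local Open Scope nat_scope.

(* The point p and the line l are coded by p and 7 + l. *)
Definition fano_edges : seq (nat * nat) :=
  [seq ((l + k) %% 7, 7 + l) | l <- iota 0 7, k <- [:: 0; 1; 3]].

Definition remaining (s : seq (nat * nat)) := [seq c <- fano_edges | c \notin s].

Definition partners (E : seq (nat * nat)) x :=
  [seq c.2 | c <- E & c.1 == x] ++ [seq c.1 | c <- E & c.2 == x].

(* Sorting lists the neighbours in the order of [fano_vertices]. *)
Definition code_sort (r : seq nat) := [seq y <- iota 0 14 | y \in r].

(** Tabulated, so that evaluation computes the neighbour lists of a graph only once. *)
Definition code_neighbours E : nat -> seq nat :=
  nth [::] [seq code_sort (partners E x) | x <- iota 0 14].

Lemma mem_partners E x y : (y \in partners E x) = ((x, y) \in E) || ((y, x) \in E).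
Proof.
rewrite mem_cat; congr (_ || _); apply/mapP/idP => [[[a b]]|xyE].
- by rewrite mem_filter /= => /andP[/eqP-> abE] ->.
- by exists (x, y); rewrite ?mem_filter ?eqxx.
- by rewrite mem_filter /= => /andP[/eqP-> abE] ->.
- by exists (y, x); rewrite ?mem_filter ?eqxx.
Qed.

(* (2 n1, 2 n2, P, T): a non-branching path is counted in both directions. *)
Definition count_rows : seq (nat * nat * nat * nat) :=
  [:: (18, 0, 66, 216); (16, 4, 64, 208); (16, 6, 64, 210);
      (14, 8, 62, 196); (12, 12, 60, 180)].

(** Edges are disjoint when both their points and their lines differ. Increasing lines make the
    lines distinct and list each set of three edges once. *)
Definition disjoint_triples : seq (seq (nat * nat)) :=
  flatten [seq [seq [:: e; f; g] | f <- [seq f <- fano_edges | (e.2 < f.2) && (e.1 != f.1)],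
     g <- [seq g <- fano_edges | [&& f.2 < g.2, e.1 != g.1 & f.1 != g.1]]] | e <- fano_edges].

(** Exhaustive evaluation. No two rows of [count_rows] agree in their first two entries, so these
    determine the other two; the degree bound serves [counts_cat0_rank]. *)
Lemma code_neighbours_counts :
  all (fun s => let nbrs := code_neighbours (remaining s) in
    (counts nbrs (iota 0 14) \in count_rows) && all (fun x => deg nbrs x <= 3) (iota 0 14))
  disjoint_triples.
Proof. by vm_compute. Qed.

End FanoCodes.

(** * Coding the incidence graph by natural numbers *)

Definition vertex_code (v : 'I_7 + 'I_7) : nat :=
  match v with inl p => val p | inr l => (7 + val l)%N end.

Lemma vertex_code_inj : injective vertex_code.
Proof.
move=> [p|l] [q|m] /= E; first by congr inl; apply: val_inj.
- by have := ltn_ord p; rewrite E -ltn_subRL subnn.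
- by have := ltn_ord q; rewrite -E -ltn_subRL subnn.
by congr inr; apply/val_inj/(addnI E).
Qed.

Definition flag_code (e : flag) : nat * nat := (val (val e).1, (7 + val (val e).2)%N).

Lemma flag_code_inj : injective flag_code.
Proof.
by move=> [[p l] e] [[q m] f] [/= /val_inj pq /addnI/val_inj lm]; apply: val_inj; rewrite /= pq lm.
Qed.

Lemma fano_edgesP c : c \in fano_edges <-> exists e : flag, c = flag_code e.
Proof.
split=> [/allpairsPdep[l [k [+ k013 ->]]]|[[[p l] /= e] ->]].
  rewrite mem_iota => /andP[_ l7]; have p7 : ((l + k) %% 7 < 7)%N by rewrite ltn_mod.
  have e : incident (Ordinal p7) (Ordinal l7) by apply/mapP; exists k.
  by exists (exist _ (Ordinal p7, Ordinal l7) e).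
have /mapP[k k013 pE] := e; apply/allpairsPdep; exists (val l), k; split=> //.
  by rewrite mem_iota /=.
by rewrite /flag_code /= pE.
Qed.

Definition fano_vertices : seq ('I_7 + 'I_7) :=
  [seq inl p | p <- enum 'I_7] ++ [seq inr l | l <- enum 'I_7].

Lemma fano_vertices_perm : perm_eq (index_enum ('I_7 + 'I_7)%type) fano_vertices.
Proof.
apply: uniq_perm; first exact: index_enum_uniq.
  rewrite cat_uniq !map_inj_uniq -?enumT ?enum_uniq ?andbT /=; [|by move=> ? ? []..].
  by apply/hasPn => _ /mapP[l _ ->]; apply/mapP => -[].
move=> v; rewrite mem_index_enum mem_cat; apply/esym/orP.
by case: v => i; [left|right]; apply: map_f; rewrite mem_enum.
Qed.

Lemma fano_vertices_code : map vertex_code fano_vertices = iota 0 14.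
Proof.
rewrite map_cat (iotaD 0 7 7) -[(0 + 7)%N]/(7 + 0)%N iotaDl -(val_enum_ord 7).
by congr cat; rewrite -!map_comp; apply: eq_map.
Qed.

Section ThreeDeleted.
Variables (R : realType) (D : {set flag}) (s : seq flag).
Hypothesis Ds : D =i s.

Let G := @delete_edges R (fano_graph R) D.

Lemma delete_dart_inj : injective (fun d : dart G => (origin d, terminus d)).
Proof.
move=> [[e eD] b] [[f fD] c] [] /=; rewrite /origin /terminus.
case: b c => -[] //= [E1] [E2]; congr (_, _); apply: val_inj => /=.
  by apply: flag_code_inj; rewrite /flag_code E1 E2.
by apply: flag_code_inj; rewrite /flag_code E1 E2.
Qed.

Lemma mem_remaining c :
  c \in remaining (map flag_code s) <-> exists2 e, e \notin D & c = flag_code e.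
Proof.
rewrite mem_filter; split=> [/andP[cs /fano_edgesP[e ce]]|[e eD ->]].
  by exists e => //; rewrite Ds -(mem_map flag_code_inj) -ce.
by rewrite (mem_map flag_code_inj) -Ds eD; apply/fano_edgesP; exists e.
Qed.

(** An edge goes from its point to its line, so its two darts match the two clauses of
    [mem_partners]. *)
Lemma edge_rel_code (v w : vert G) : edge_rel v w =
  (vertex_code w \in partners (remaining (map flag_code s)) (vertex_code v)).
Proof.
rewrite mem_partners; apply/existsP/orP => [[[[e eD] [] /=]]|].
- rewrite /origin /terminus /= => /andP[/eqP<- /eqP<-]; right.
  by apply/mem_remaining; exists e.
- rewrite /origin /terminus /= => /andP[/eqP<- /eqP<-]; left.
  by apply/mem_remaining; exists e.
have codeE (x y : 'I_7 + 'I_7) e : (vertex_code x, vertex_code y) = flag_code e ->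
    x = inl (val e).1 /\ y = inr (val e).2.
  by move=> [xe ye]; split; apply: vertex_code_inj.
move=> [/mem_remaining[e eD /codeE[-> ->]]|/mem_remaining[e eD /codeE[-> ->]]].
  by exists (exist _ e eD, false); rewrite /origin /terminus !eqxx.
by exists (exist _ e eD, true); rewrite /origin /terminus !eqxx.
Qed.

Lemma vertex_code_lt v : (vertex_code v < 14)%N.
Proof.
have : vertex_code v \in iota 0 14.
  by rewrite -fano_vertices_code map_f // -(perm_mem fano_vertices_perm) mem_index_enum.
by rewrite mem_iota.
Qed.

(** An equality of lists, as [counts_map] requires: both sides filter the vertices in the same
    order. *)
Lemma neighbours_code (v : vert G) :
  code_neighbours (remaining (map flag_code s)) (vertex_code v) =
  map vertex_code (@neighbours R G fano_vertices v).
Proof.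
rewrite /code_neighbours (nth_map 0%N) ?size_iota ?vertex_code_lt //.
rewrite nth_iota ?vertex_code_lt // add0n /code_sort.
rewrite -fano_vertices_code filter_map; congr map.
by apply: eq_filter => w; rewrite /= -edge_rel_code.
Qed.

End ThreeDeleted.

(** * From sets of deleted edges to the enumerated triples *)

Lemma sorted_three_disjoint (R : realType) (D : {set flag}) :
  @three_disjoint R D -> exists2 s, D =i s & map flag_code s \in disjoint_triples.
Proof.
move=> [D3 Ddisj].
(* Sorting by lines gives the order of [disjoint_triples]; the inequalities become strict because
   disjoint edges have distinct lines. *)
pose r (e f : flag) := (val (val e).2 <= val (val f).2)%N.
pose s := sort r (enum D).
have sD : D =i s by move=> e; rewrite mem_sort mem_enum.
have ss : size s = 3%N by rewrite size_sort -cardE.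
have srt : sorted r s by apply: sort_sorted => e f; apply: leq_total.
have us : uniq s by rewrite sort_uniq enum_uniq.
exists s => //; clearbody s.
case: s => [|e [|f [|g []]]] // in sD ss srt us *.
have ne (a b : flag) : a \in D -> b \in D -> a != b ->
    (flag_code a).1 != (flag_code b).1 /\ (flag_code a).2 != (flag_code b).2.
  move=> aD bD ab; have dab := Ddisj a b aD bD ab.
  split; apply/eqP; [move=> /val_inj E|move=> /addnI/val_inj E].
    have := disjointFr dab (set21 (inl (val a).1) _).
    by rewrite /= !inE E eqxx.
  have := disjointFr dab (set22 _ (inr (val a).2)).
  by rewrite /= !inE E eqxx orbT.
have uniq3 (T : eqType) (a b c : T) :
    uniq [:: a; b; c] -> [/\ a != b, a != c & b != c].
  by rewrite /= !inE negb_or => /and3P[/andP[]].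
have [ef eg fg] := uniq3 _ _ _ _ us.
have [eD fD gD] : [/\ e \in D, f \in D & g \in D] by rewrite !sD !inE !eqxx !orbT.
have [ef1 ef2] := ne e f eD fD ef; have [eg1 eg2] := ne e g eD gD eg.
have [fg1 fg2] := ne f g fD gD fg.
have lt (a b : flag) : r a b -> (flag_code a).2 != (flag_code b).2 ->
    ((flag_code a).2 < (flag_code b).2)%N.
  by move=> rab nab; rewrite ltn_neqAle nab leq_add2l.
move: srt => /= /and3P[/lt/(_ ef2) elf /lt/(_ fg2) flg _].
rewrite /disjoint_triples; apply/flatten_mapP.
exists (flag_code e); first by apply/fano_edgesP; exists e.
apply/allpairsPdep; exists (flag_code f), (flag_code g); split=> //.
  by rewrite mem_filter elf ef1; apply/fano_edgesP; exists f.
by rewrite mem_filter flg eg1 fg1; apply/fano_edgesP; exists g.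
Qed.

(** The counts evaluated on codes are those of the graph; halving undoes the counting of
    non-branching paths in both directions. *)
Lemma three_missing_counts (R : realType) (G : mgraph R) : three_missing G ->
  exists2 c, c \in count_rows &
  [/\ nonbranching_mult G (1%:R * (pi / 3)) = c.1.1.1./2,
      nonbranching_mult G (2%:R * (pi / 3)) = c.1.1.2./2 &
      cat0_rank G = c.2%:R / (2 * c.1.2)%:R].
Proof.
move=> [D /sorted_three_disjoint[s Ds sdt] ->].
have /andP[] := allP code_neighbours_counts _ sdt.
rewrite -fano_vertices_code (counts_map vertex_code_inj (@neighbours_code R D s Ds)).
set c := counts _ _ => c_rows /allP deg3; exists c => //.
set G' := delete_edges D.
have vs_perm : perm_eq (index_enum (vert G')) fano_vertices := fano_vertices_perm.
have dart_inj := @delete_dart_inj R D.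
have len3 (e : edge G') : len e = pi / 3 by [].
have card14 : #|vert G'| = 14%N by rewrite card_sum card_ord.
split.
- by rewrite (counts_nonbranching_mult vs_perm) ?card14.
- by rewrite (counts_nonbranching_mult vs_perm) ?card14.
apply: (counts_cat0_rank vs_perm) => // v.
rewrite (valency_deg vs_perm) // -(deg_map (@neighbours_code R D s Ds)).
by apply: deg3; rewrite map_f // -(perm_mem vs_perm) mem_index_enum.
Qed.

(** * The six ranks *)

Lemma natmul_third_pi_inj (R : realType) (k j : nat) :
  (k%:R * (pi / 3) == j%:R * (pi / 3) :> R) = (k == j).
Proof. by rewrite (inj_eq (mulIf (lt0r_neq0 (third_pi_gt0 R)))) eqr_nat. Qed.

Theorem proposition4p9 (R : realType) :
  (forall G : mgraph R, is_G1 G -> cat0_rank G = 18 / 11) /\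
  (forall G : mgraph R, is_G2 G -> cat0_rank G = 13 / 8) /\
  (forall G : mgraph R, is_G3 G -> cat0_rank G = 105 / 64) /\
  (forall G : mgraph R, is_G4 G -> cat0_rank G = 49 / 31) /\
  (forall G : mgraph R, is_G5 G -> cat0_rank G = 3 / 2) /\
  (forall G : mgraph R, is_G6 G -> cat0_rank G = 3 / 2).
Proof.
(* All listed lengths are multiples of [pi / 3], so multiplicities can be counted on the list of
   multipliers. *)
pose t (k : nat) : R := k%:R * (pi / 3).
have t1 : t 1%N = pi / 3 by rewrite /t mul1r.
have t2 : t 2%N = 2 * pi / 3 by rewrite /t mulrA.
have t3 : t 3%N = pi by rewrite /t; field.
have t4 : t 4%N = 4 * pi / 3 by rewrite /t mulrA.
(* The equation on [count_rows] says that the multiplicities of [pi / 3] and [2 * pi / 3] select a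
   single row; for each concrete [s] it holds by evaluation. *)
have rank G (s : seq nat) c :
    three_missing G -> nonbranching_lengths G (map t s) ->
    [seq c <- count_rows | (c.1.1.1./2 == count_mem 1%N s) && (c.1.1.2./2 == count_mem 2%N s)]
      = [:: c] ->
    cat0_rank G = c.2%:R / (2 * c.1.2)%:R.
  move=> /three_missing_counts[d d_row [n1 n2 ->]] sE cE.
  have mult k : nonbranching_mult G (t k) = count_mem k s.
    by rewrite sE count_map; apply: eq_count => j; rewrite /= natmul_third_pi_inj.
  suff: d \in [:: c] by rewrite inE => /eqP->.
  by rewrite -cE mem_filter d_row -!mult /t n1 n2 !eqxx.
split=> [G [G3]|].
  rewrite -t1 -t3 -!(map_nseq _ t) -map_cat => /(rank _ _ (18, 0, 66, 216)%N G3)/(_ erefl)->.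
  by rewrite natrM /=; field.
split=> [G [G3]|].
  rewrite -t1 -t2 -t3 -!(map_nseq _ t) -!map_cat => /(rank _ _ (16, 4, 64, 208)%N G3)/(_ erefl)->.
  by rewrite natrM /=; field.
split=> [G [G3]|].
  rewrite -t1 -t2 -t4 -!(map_nseq _ t) -!map_cat => /(rank _ _ (16, 6, 64, 210)%N G3)/(_ erefl)->.
  by rewrite natrM /=; field.
split=> [G [G3]|].
  rewrite -t1 -t2 -t3 -!(map_nseq _ t) -!map_cat => /(rank _ _ (14, 8, 62, 196)%N G3)/(_ erefl)->.
  by rewrite natrM /=; field.
split=> G [G3 + _].
  rewrite -t1 -t2 -!(map_nseq _ t) -!map_cat => /(rank _ _ (12, 12, 60, 180)%N G3)/(_ erefl)->.
  by rewrite natrM /=; field.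
rewrite -t1 -t2 -!(map_nseq _ t) -!map_cat => /(rank _ _ (12, 12, 60, 180)%N G3)/(_ erefl)->.
by rewrite natrM /=; field.
Qed.
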